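(* Fix $p\in(0,1)$ and let $A\subset\mathbb{N}$ be a random subset distributed as $\mathbb{N}_p$, i.e. each $n\in\mathbb{N}$ is included in $A$ independently with probability $p$. Then with probability $1$ the following holds: for every integer $L\ge 1$ there exist integers $x_1<\cdots<x_L$ in $\mathbb{N}$ such that \[ \operatorname{FS}(x_1,\dots,x_L)\subset A . \]
   Context: $\mathbb{N}=\{1,2,3,\dots\}$. For $x_1,\dots,x_L\in\mathbb{N}$, the finite sumset is \[ \operatorname{FS}(x_1,\dots,x_L):=\Big\{\sum_{i\in F}x_i:\ \varnothing\ne F\subset\{1,\dots,L\}\Big\}. \] $\mathbb{N}_p$ denotes the law of the random subset of $\mathbb{N}$ obtained by including each $n\in\mathbb{N}$ independently with probability $p$. *)

(* Defs.v *)
From HB Require Import structures.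
From mathcomp Require Import all_boot all_order all_algebra.
From mathcomp Require Import finmap.
From mathcomp Require Import all_classical all_reals all_analysis.

Set Implicit Arguments.
Unset Strict Implicit.
Unset Printing Implicit Defensive.

Import Order.TTheory GRing.Theory Num.Theory.

Local Open Scope classical_set_scope.

(* The set of natural numbers {1, 2, 3, ...}, without 0. *)
Definition posnat : set nat := [set n | (0 < n)%N].

Definition mutually_independent_events (d : measure_display)
    (T : measurableType d) (R : realType) (P : probability T R)
    (I : choiceType) (D : set I) (E : I -> set T) : Prop :=
  (forall i, D i -> measurable (E i)) /\
  (forall J : {fset I}, [set` J] `<=` D ->
     P (\bigcap_(i in [set` J]) E i) = (\prod_(i <- J) P (E i))%E).

(* "A is distributed as N_p" is read through the inclusion events [n \in A]. *)
Definition random_subset_Np (d : measure_display) (T : measurableType d)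
    (R : realType) (P : probability T R) (p : R) (A : T -> set nat) : Prop :=
  [/\ forall w, A w `<=` posnat,
      mutually_independent_events P posnat (fun n => [set w | A w n])
    & forall n, posnat n -> P [set w | A w n] = p%:E].

(* The terms x_1, ..., x_L are indexed by 'I_L, i.e. from 0 to L - 1. *)
Definition FS (L : nat) (x : 'I_L -> nat) : set nat :=
  [set (\sum_(i in F) x i)%N | F in [set F : {set 'I_L} | F != finset.set0]].

(* Main.v *)
(** Fix [L].  The sets [2 ^ (L * k) * {1, ..., 2 ^ L - 1}], for [k = 0, 1, ...],
    are pairwise disjoint finite sumsets of [L] terms, all of the same size, so
    each lies in the random set with the same positive probability, independently
    of the others.  Almost surely one of them does; then let [L] vary over the
    countable set of lengths. *)
Require Import Defs.
From HB Require Import structures.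
From mathcomp Require Import all_boot all_order all_algebra.
From mathcomp Require Import finmap.
From mathcomp Require Import all_classical all_reals all_analysis.

Set Implicit Arguments.
Unset Strict Implicit.
Unset Printing Implicit Defensive.

Import Order.TTheory GRing.Theory Num.Theory.
Import numFieldNormedType.Exports.

Local Open Scope classical_set_scope.

Lemma prode_EFin_const (R : numDomainType) (I : choiceType) (J : {fset I})
    (f : I -> \bar R) (p : R) :
  (forall i, i \in J -> f i = p%:E) ->
  (\prod_(i <- J) f i)%E = (p ^+ #|` J|)%:E.
Proof.
move=> fp; rewrite (eq_big_seq (fun=> p%:E)) //.
rewrite big_const_seq count_predT; elim: (size _) => //= n ->.
by rewrite exprS EFinM.
Qed.

Section independent_events.
Context (R : realType) (d : measure_display) (T : measurableType d).
Context (P : probability T R) (I : choiceType) (D : set I) (E : I -> set T).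
Context (p : R) (Eindep : mutually_independent_events P D E).
Context (PE : forall i, D i -> P (E i) = p%:E).

Let all_in (J : {fset I}) := \bigcap_(i in [set` J]) E i.

Let all_inU (J K : {fset I}) : all_in (J `|` K)%fset = all_in J `&` all_in K.
Proof. by rewrite /all_in set_fsetU bigcap_setU. Qed.

Lemma measurable_fset_bigcap (J : {fset I}) :
  [set` J] `<=` D -> measurable (all_in J).
Proof.
move=> JD; apply: fin_bigcap_measurable => [|i /JD Di].
  exact: finite_fset.
exact: Eindep.1.
Qed.

(* The extra family [J] makes the induction on [n] go through: removing the event
   that [S n] occurs replaces [J] by [J `|` S n]. *)
Lemma prob_fset_bigcap_avoid (S : nat -> {fset I}) (s : nat) :
  (forall k, [set` S k] `<=` D) -> (forall k, #|` S k| = s) ->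
  (forall j k, (j < k)%N -> [disjoint S j & S k]%fset) ->
  forall (n : nat) (J : {fset I}), [set` J] `<=` D ->
  (forall k, (k < n)%N -> [disjoint J & S k]%fset) ->
  P (all_in J `&` \big[setI/setT]_(k < n) ~` all_in (S k)) =
  (p ^+ #|` J| * (1 - p ^+ s) ^+ n)%:E.
Proof.
move=> SD cardS disjS; elim=> [|n IH] J JD disjJ.
  rewrite big_ord0 setIT expr0 mulr1 /all_in Eindep.2 //.
  by apply: prode_EFin_const => i iJ; rewrite PE //; exact: JD.
have disjJn k : (k < n)%N -> [disjoint J & S k]%fset.
  by move=> kn; apply: disjJ; exact: ltnW.
have JSD : [set` (J `|` S n)%fset] `<=` D.
  by rewrite set_fsetU => i [/JD//|/SD].
have mI : measurable (all_in J `&` \big[setI/setT]_(k < n) ~` all_in (S k)).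
  apply: measurableI; first exact: measurable_fset_bigcap.
  by apply: bigsetI_measurable => k _; apply/measurableC/measurable_fset_bigcap.
rewrite big_ord_recr /= setIA -setDE.
set N := \big[_/_]_(k < n) _ in mI *.
(* Complements are traded for a difference: missing [S n] removes from [all_in J] the part where all
   of [J] and [S n] occurs. *)
transitivity (P (all_in J `&` N) - P (all_in (J `|` S n)%fset `&` N))%E.
  rewrite all_inU setIAC measureD //; first exact: measurable_fset_bigcap.
  by rewrite ltey_eq fin_num_measure.
(* Both terms fall under the induction hypothesis, the second because [S n] is disjoint from every
   earlier [S k]. *)
rewrite !IH //; last first.
  move=> k kn; rewrite fdisjointUX disjJn //= fdisjoint_sym.
  exact: disjS.
have cardJS : #|` (J `|` S n)%fset| = (#|` J| + s)%N.
  have /eqP JS0 := disjJ n (ltnSn n).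
  by rewrite cardfsU JS0 cardfs0 subn0 cardS.
rewrite cardJS -EFinB exprD exprSr; congr EFin.
by rewrite mulrBr mulr1 mulrBr -!mulrA [X in (_ - _ * X)%R]mulrC.
Qed.

(** Failure for all [k] forces failure for each [k < n], an event of probability
    [(1 - p ^+ s) ^+ n]; this tends to 0 because [0 < p ^+ s <= 1]. *)
Lemma ae_exists_fset_bigcap (S : nat -> {fset I}) (s : nat) :
  (0 < p)%R -> (p <= 1)%R ->
  (forall k, [set` S k] `<=` D) -> (forall k, #|` S k| = s) ->
  (forall j k, (j < k)%N -> [disjoint S j & S k]%fset) ->
  {ae P, forall w, exists k, forall i, i \in S k -> E i w}.
Proof.
move=> p0 p1 SD cardS disjS.
have mC k : measurable (~` all_in (S k)).
  exact/measurableC/measurable_fset_bigcap.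
have mM : measurable (\bigcap_k ~` all_in (S k)) by exact: bigcapT_measurable.
exists (\bigcap_k ~` all_in (S k)); split => //; last first.
  move=> w /= noS k _ Sk; apply: noS; exists k => i iS.
  exact: Sk.
have le_geo n : (P (\bigcap_k ~` all_in (S k)) <= ((1 - p ^+ s) ^+ n)%:E)%E.
  have := prob_fset_bigcap_avoid SD cardS disjS (n := n) (J := fset0).
  rewrite cardfs0 expr0 mul1r => <- //; last first.
    by move=> k _; exact: fdisjoint0X.
  apply: le_measure; rewrite ?inE //.
    apply: measurableI; first exact: measurable_fset_bigcap.
    exact: bigsetI_measurable.
  move=> w Sw; split=> [i //|].
  by rewrite -(bigcap_mkord n (fun k => ~` all_in (S k))) => k _; exact: Sw.
have q0 : (0 < p ^+ s)%R by rewrite exprn_gt0.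
have q1 : (p ^+ s <= 1)%R by rewrite exprn_ile1 // ltW.
apply/eqP; rewrite eq_le measure_ge0 andbT.
have fP : P (\bigcap_k ~` all_in (S k)) \is a fin_num by exact: fin_num_measure.
move: le_geo; rewrite -(fineK fP) => le_geo; rewrite lee_fin.
have cvg0 : ((1 - p ^+ s) ^+ n)%R @[n --> \oo] --> (0 : R)%R.
  by apply: cvg_expr; rewrite ger0_norm ?subr_ge0// ltrBlDr ltrDl.
rewrite -(cvg_lim _ cvg0) //; apply: limr_ge; first by apply/cvg_ex; exists 0%R.
by apply: nearW => n; rewrite -lee_fin.
Qed.

End independent_events.

(** These are the positive integers whose binary digits 1 all sit in positions [L * k] to
    [L * k + L - 1]. *)
Definition dyadic_block (L k : nat) : {fset nat} :=
  [fset (2 ^ (L * k) * m)%N | m in iota 1 (2 ^ L).-1]%fset.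

Lemma dyadic_blockP (L k n : nat) :
  reflect (exists2 m, (0 < m < 2 ^ L)%N & n = (2 ^ (L * k) * m)%N)
          (n \in dyadic_block L k).
Proof.
have memE m : (m \in iota 1 (2 ^ L).-1) = (0 < m < 2 ^ L)%N.
  by rewrite mem_iota add1n prednK // expn_gt0.
apply: (iffP idP) => [/imfsetP[m /= mL ->]|[m mL ->]].
  by exists m; rewrite -?memE.
by apply/imfsetP; exists m; rewrite //= memE.
Qed.

Lemma card_dyadic_block (L k : nat) : #|` dyadic_block L k| = (2 ^ L).-1.
Proof.
rewrite card_imfset /=; last first.
  by move=> a b /eqP; rewrite eqn_pmul2l ?expn_gt0// => /eqP.
by rewrite undup_id ?iota_uniq// size_iota.
Qed.

(** The power [2 ^ (L * j.+1)] separates the two blocks: it exceeds all of block [j] and is at most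
    every element of block [k]. *)
Lemma disjoint_dyadic_block (L j k : nat) :
  (j < k)%N -> [disjoint dyadic_block L j & dyadic_block L k]%fset.
Proof.
move=> jk; apply/fdisjointP => n /dyadic_blockP[a /andP[_ aL] ->].
apply/negP => /dyadic_blockP[b /andP[b0 _] ab].
suff : (2 ^ (L * j) * a < 2 ^ (L * k) * b)%N by rewrite ab ltnn.
apply: (@leq_trans (2 ^ (L * j.+1))); last first.
  by apply: leq_trans (leq_pmulr _ b0); rewrite leq_exp2l// leq_mul2l jk orbT.
by rewrite mulnS addnC expnD ltn_pmul2l ?expn_gt0.
Qed.

Lemma FS_dyadic_block (L k : nat) :
  FS (fun i : 'I_L => 2 ^ (L * k) * 2 ^ i)%N `<=` [set` dyadic_block L k].
Proof.
move=> _ [F F0 <-]; apply/dyadic_blockP; exists (\sum_(i in F) 2 ^ i)%N.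
  apply/andP; split.
    have /set0Pn[i iF] := F0.
    by rewrite (bigD1 i) //= addn_gt0 expn_gt0.
  apply: (@leq_ltn_trans (\sum_(i < L) 2 ^ i)%N).
    by rewrite [leqRHS](bigID (mem F)) leq_addr.
  (* The full sum is geometric, equal to [2 ^ L - 1]; the factor 1 is written [2.-1] to match the
     closed form. *)
  by rewrite -[X in (X < _)%N]mul1n -[1%N]/2.-1 -predn_exp ltn_predL expn_gt0.
by rewrite big_distrr.
Qed.

Theorem theoremA (R : realType) (d : measure_display) (T : measurableType d)
    (P : probability T R) (p : R) (hp0 : (0 < p)%R) (hp1 : (p < 1)%R)
    (A : T -> set nat) (hA : random_subset_Np P p A) :
  {ae P, forall w, forall L : nat, (1 <= L)%N ->
    exists x : 'I_L -> nat,
      [/\ forall i, posnat (x i),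
          forall i j : 'I_L, (i < j)%N -> (x i < x j)%N
        & FS x `<=` A w]}.
Proof.
have [_ Aindep PA] := hA.
apply: ae_foralln => L.
have blockD k : [set` dyadic_block L k] `<=` posnat.
  move=> _ /dyadic_blockP[m /andP[m0 _] ->].
  by rewrite /posnat /= muln_gt0 expn_gt0.
apply: filterS (ae_exists_fset_bigcap Aindep PA hp0 (ltW hp1) blockD
  (card_dyadic_block L) (@disjoint_dyadic_block L)) => w [k blockA] _.
(* The block index [k] depends on the outcome [w]; the terms are the [L] powers of two inside that
   block. *)
exists (fun i : 'I_L => 2 ^ (L * k) * 2 ^ i)%N; split.
- by move=> i; rewrite /posnat /= muln_gt0 !expn_gt0.
- by move=> i j ij; rewrite ltn_pmul2l ?expn_gt0// ltn_exp2l.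
- by move=> n /FS_dyadic_block; exact: blockA.
Qed.
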